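(* Let $V$ and $W$ be finite-dimensional real inner product spaces, let $A\colon V\to V$ be a symmetric positive definite linear operator, and let $B\colon V\to W$ be a surjective linear operator. Let $S = BA^{-1}B^t\colon W\to W$. Then $$\lambda_{\min}(S)=\inf_{0\neq q\in W}\ \sup_{v\in V,\ Bv=q}\frac{\|q\|^2}{(Av,v)},\qquad \lambda_{\max}(S)=\sup_{0\neq v\in V}\frac{\|Bv\|^2}{(Av,v)}.$$
   Context: All inner products are denoted $(\cdot,\cdot)$ with associated norms $\|\cdot\|$. $B^t\colon W\to V$ is the adjoint of $B$ with respect to these inner products. ''Symmetric positive definite'' means self-adjoint with $(Av,v)>0$ for all $v\ne 0$. $S=BA^{-1}B^t$ is the Schur complement of the saddle point system $Au+B^tp=f$, $Bu=g$ (with $f\in V$, $g\in W$). $\lambda_{\min}$ and $\lambda_{\max}$ denote the minimum and maximum eigenvalues of an operator (so $W$ is understood to be nonzero). *)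

(* Defs.v *)
From HB Require Import structures.
From mathcomp Require Import all_boot all_order all_algebra.
From mathcomp Require Import all_classical all_reals.
From mathcomp Require Import ereal.
Set Implicit Arguments.
Unset Strict Implicit.
Unset Printing Implicit Defensive.
Import Order.TTheory GRing.Theory Num.Theory.
Local Open Scope classical_set_scope.
Local Open Scope ring_scope.

(* A finite-dimensional real inner product space is a [V : vectType R] together
   with a positive definite symmetric bilinear form [dV : {dot V for idfun}]. *)

Section InnerProduct.
Variable R : realType.

Definition dot_norm (V : vectType R) (dV : {dot V for idfun}) (v : V) : R :=
  Num.sqrt (dV v v).

Definition is_adjoint (V W : vectType R) (dV : {dot V for idfun})
    (dW : {dot W for idfun}) (B : 'Hom(V, W)) (C : 'Hom(W, V)) : Prop :=
  forall v w, dW (B v) w = dV v (C w).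

(* The default value 0 is never taken: see [adjointP]. *)
Definition adjoint (V W : vectType R) (dV : {dot V for idfun})
    (dW : {dot W for idfun}) (B : 'Hom(V, W)) : 'Hom(W, V) :=
  xget 0 [set C | is_adjoint dV dW B C].

Definition sym_pos_def (V : vectType R) (dV : {dot V for idfun})
    (A : 'End(V)) : Prop :=
  is_adjoint dV dV A A /\ forall v, v != 0 -> 0 < dV (A v) v.

(* For symmetric positive definite [A], [A^-1] is the two-sided inverse of [A]:
   see [sym_pos_def_invl] and [sym_pos_def_invr]. *)
Definition schur_complement (V W : vectType R) (dV : {dot V for idfun})
    (dW : {dot W for idfun}) (A : 'End(V)) (B : 'Hom(V, W)) : 'End(W) :=
  (B \o (A^-1 \o adjoint dV dW B))%VF.

Definition is_min_eigenvalue (W : vectType R) (S : 'End(W)) (l : R) : Prop :=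
  passmx.leigenvalue S l /\ forall m, passmx.leigenvalue S m -> l <= m.

Definition is_max_eigenvalue (W : vectType R) (S : 'End(W)) (l : R) : Prop :=
  passmx.leigenvalue S l /\ forall m, passmx.leigenvalue S m -> m <= l.

Lemma dot_inj (V : vectType R) (dV : {dot V for idfun}) u v :
  (forall x, dV x u = dV x v) -> u = v.
Proof.
move=> h; apply/eqP; rewrite -subr_eq0; apply: contraT => /(neq0_dnorm_gt0 (s:=dV)).
by rewrite linearBr /= h subrr ltxx.
Qed.

Lemma riesz (V : vectType R) (dV : {dot V for idfun}) (f : {linear V -> R^o}) :
  exists c, forall v, f v = dV v c.
Proof.
pose phi c := linfun (applyr dV c : V -> R^o).
have phiE c v : phi c v = dV v c.
  by rewrite lfunE.
have phi_lin : linear phi.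
  move=> a x y; apply/lfunP => v.
  by rewrite add_lfunE scale_lfunE !phiE linearPr.
pose L := GRing.isLinear.Build _ _ _ _ phi phi_lin.
pose Phi : {linear V -> 'Hom(V, R^o)} := HB.pack phi L.
have inj : lker (linfun Phi) == 0%VS.
  apply/lker0P => x y; rewrite !lfunE /= => exy.
  by apply: (dot_inj (dV := dV)) => v; rewrite -!phiE exy.
have full : limg (linfun Phi) = fullv.
  apply/eqP; rewrite eqEdim subvf /= limg_dim_eq; last first.
    by rewrite (eqP inj) capv0.
  by rewrite !dimvf /dim /= muln1.
have := memvf (linfun f); rewrite -full => /memv_imgP[c _ ec].
exists c => v; have := congr1 (fun g : 'Hom(V, R^o) => g v) ec.
by rewrite !lfunE.
Qed.

Lemma adjointP (V W : vectType R) (dV : {dot V for idfun})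
    (dW : {dot W for idfun}) (B : 'Hom(V, W)) :
  is_adjoint dV dW B (adjoint dV dW B).
Proof.
suff [C hC] : exists C, is_adjoint dV dW B C by exact: (xgetI 0 hC).
have ex w : exists c, forall v, dW (B v) w = dV v c.
  have lin : linear (fun v : V => dW (B v) w : R^o).
    by move=> a x y; rewrite linearP linearPl.
  pose L := GRing.isLinear.Build _ _ _ _ _ lin.
  pose f : {linear V -> R^o} := HB.pack (fun v : V => dW (B v) w : R^o) L.
  exact: (riesz dV f).
have [g hg] := choice ex.
have lin : linear g.
  move=> a x y; apply: (dot_inj (dV := dV)) => v.
  by rewrite -hg !linearPr /= !hg.
pose L := GRing.isLinear.Build _ _ _ _ _ lin.
pose G : {linear W -> V} := HB.pack g L.
by exists (linfun G) => v w; rewrite lfunE /= hg.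
Qed.

Lemma sym_pos_def_lker0 (V : vectType R) (dV : {dot V for idfun})
  (A : 'End(V)) : sym_pos_def dV A -> lker A == 0%VS.
Proof.
move=> [_ pA]; rewrite -subv0; apply/subvP => v; rewrite memv_ker memv0 => /eqP Av.
by apply: contraT => /pA; rewrite Av linear0l ltxx.
Qed.

Lemma sym_pos_def_invl (V : vectType R) (dV : {dot V for idfun})
  (A : 'End(V)) : sym_pos_def dV A -> cancel A (A^-1)%VF.
Proof. by move=> /sym_pos_def_lker0; exact: lker0_lfunK. Qed.

Lemma sym_pos_def_invr (V : vectType R) (dV : {dot V for idfun})
  (A : 'End(V)) : sym_pos_def dV A -> cancel (A^-1)%VF A.
Proof. by move=> /sym_pos_def_lker0; exact: lker0_lfunVK. Qed.

End InnerProduct.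

(* Main.v *)
Require Import Defs.
From HB Require Import structures.
From mathcomp Require Import all_boot all_order all_algebra.
From mathcomp Require Import all_classical all_reals.
From mathcomp Require Import ereal.
From mathcomp Require Import ring lra.
Set Implicit Arguments.
Unset Strict Implicit.
Unset Printing Implicit Defensive.
Import Order.TTheory GRing.Theory Num.Theory.
Local Open Scope classical_set_scope.
Local Open Scope ring_scope.

(** Everything rests on one inequality. Write [B^t] for the adjoint of [B] and
    lift [q : W] to [A^-1 (B^t q)] ([optimal_lift]). The lift represents the
    functional [v |-> (B v, q)] for the inner product [(A u, v)], and its energy
    [(A v, v)] is [(S q, q)]. The Cauchy-Schwarz inequality for [(A u, v)]
    therefore reads
      [(B v, q)^2 <= (A v, v) (S q, q)],
    with equality when [v] is the lift of [q] ([schur_cauchy_schwarz]).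

    Taking [q = B v] bounds the quotient [|B v|^2 / (A v, v)] by the Rayleigh
    quotient of [S] at [B v], hence by its largest eigenvalue, and the lift of
    an eigenvector attains this bound. Replacing [q] by [S^-1 q] shows that the
    least energy of a [v] with [B v = q] is [(S^-1 q, q)], attained at the lift
    of [S^-1 q]. The inner supremum is thus [|q|^2 / (S^-1 q, q)], whose infimum
    over [q] is the inverse of the largest eigenvalue of [S^-1], that is, the
    smallest eigenvalue of [S].

    So the only spectral fact needed is that a self-adjoint operator [T] has an
    eigenvalue bounding its Rayleigh quotient ([max_rayleigh_eigenvalue]); it is
    applied to [S] and to [S^-1]. It is proved without compactness and without
    complex numbers: if [l] is the supremum of the Rayleigh quotient, then
    [l - T] is positive semidefinite, and if it were injective it would be
    bounded below by a positive multiple of the identity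
    ([coercive_psd_inj]), so that [l] could be lowered. *)

(** * Self-adjoint operators on a real inner product space *)

Section RealInnerProduct.
Variables (R : realType) (U : vectType R) (d : {dot U for idfun}).

Lemma dotC u v : d u v = d v u.
Proof. by rewrite hermC /= expr0 mul1r. Qed.

Lemma dotDl u v w : d (u + v) w = d u w + d v w. Proof. exact: linearDl. Qed.
Lemma dotBl u v w : d (u - v) w = d u w - d v w. Proof. exact: linearBl. Qed.
Lemma dotZl a u v : d (a *: u) v = a * d u v. Proof. exact: linearZl_LR. Qed.
Lemma dotDr u v w : d u (v + w) = d u v + d u w. Proof. exact: linearD. Qed.
Lemma dotZr a u v : d u (a *: v) = a * d u v. Proof. exact: linearZ. Qed.

Lemma dot_gt0 u : u != 0 -> 0 < d u u.
Proof. exact: neq0_dnorm_gt0. Qed.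

Lemma dot_ge0 u : 0 <= d u u.
Proof.
have [->|/dot_gt0 /ltW //] := eqVneq u 0; by rewrite linear0r.
Qed.

Lemma dot_normE u : dot_norm d u ^+ 2 = d u u.
Proof. by rewrite sqr_sqrtr // dot_ge0. Qed.

Lemma eigenvalueP (f : 'End(U)) (a : R) :
  passmx.leigenvalue f a <-> exists2 u, u != 0 & f u = a *: u.
Proof.
have kerE u : (u \in passmx.leigenspace f a) = (f u == a *: u).
  by rewrite memv_ker add_lfunE opp_lfunE scale_lfunE id_lfunE subr_eq0.
split.
  move=> nz; exists (vpick (passmx.leigenspace f a)); first by rewrite vpick0.
  by apply/eqP; rewrite -kerE memv_pick.
case=> u nzu /eqP fu; apply: contra nzu => /eqP ker0.
by rewrite -memv0 -ker0 kerE.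
Qed.

(** The form [(T u, v)] may be degenerate, which is what the shifted operator
    [l - T] of [max_rayleigh_eigenvalue] requires. As usual the inequality
    comes from the nonnegativity of the form at [s x + t y]. *)
Lemma cauchy_schwarz_psd (T : 'End(U)) (x y : U) :
  is_adjoint d d T T -> (forall u, 0 <= d (T u) u) ->
  d (T x) y ^+ 2 <= d (T x) x * d (T y) y.
Proof.
move=> symT psd.
have quad (s t : R) : 0 <= s ^+ 2 * d (T x) x + 2 * s * t * d (T x) y
                          + t ^+ 2 * d (T y) y.
  have := psd (s *: x + t *: y).
  have -> : d (T (s *: x + t *: y)) (s *: x + t *: y) =
            s * (s * d (T x) x + t * d (T x) y)
            + t * (s * d (T y) x + t * d (T y) y).
    have -> : T (s *: x + t *: y) = s *: T x + t *: T y by rewrite linearD !linearZ.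
    by rewrite dotDl !dotZl !dotDr !dotZr.
  have -> : d (T y) x = d (T x) y by rewrite symT dotC.
  by congr (_ <= _); ring.
have a0 := psd x; have := psd y.
set a := d (T x) x in quad a0 *; set b := d (T x) y in quad *.
set c := d (T y) y in quad *.
rewrite le_eqVlt => /predU1P[c0|c0].
  (* If [c = 0], the form at [b x - (a + 1) y] is [- (a + 2) b^2], so [b = 0]. *)
  have := quad b (- (a + 1)); rewrite -c0 mulr0 addr0 mulr0 => h.
  have -> : b ^+ 2 = ((a + 2) * b ^+ 2) / (a + 2) by field; lra.
  by rewrite pmulr_lle0 ?invr_gt0; nra.
(* If [c > 0], the form at [c x - b y] is [c (a c - b^2)]. *)
have := quad c (- b).
have -> : c ^+ 2 * a + 2 * c * - b * b + (- b) ^+ 2 * c = c * (a * c - b ^+ 2).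
  by ring.
by rewrite pmulr_rge0 // subr_ge0.
Qed.

Lemma cauchy_schwarz x y : d x y ^+ 2 <= d x x * d y y.
Proof.
have := @cauchy_schwarz_psd \1%VF x y; rewrite !id_lfunE; apply.
  by move=> u v; rewrite !id_lfunE.
by move=> u; rewrite id_lfunE dot_ge0.
Qed.

(** The coordinates of [x] in a basis are
    inner products with fixed vectors, so [(L x, x)] is a finite sum of products
    [(x, c) (x, e)], each at most [(|c|^2 + |e|^2) |x|^2]. *)
Lemma quadratic_form_bounded (L : 'End(U)) :
  exists2 M, 0 < M & forall x, d (L x) x <= M * d x x.
Proof.
pose b := vbasis {:U}.
have /choice[c cE] i : exists c, forall x, coord b i x = d x c.
  exact: (riesz d (coord b i)).
pose m i := d (c i) (c i) + d (L b`_i) (L b`_i).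
(* The summand 1 makes the bound positive even for the zero space. *)
exists (1 + \sum_i m i).
  by rewrite ltr_pwDl // sumr_ge0 // => i _; rewrite addr_ge0 // dot_ge0.
move=> x.
have -> : d (L x) x = \sum_i d x (c i) * d (L b`_i) x.
  rewrite {1}(coord_vbasis (memvf x)) linear_sum linear_sumlz /=.
  by apply: eq_bigr => i _; rewrite linearZ /= dotZl -cE.
rewrite mulrDl mul1r mulr_suml.
apply: (@le_trans _ _ (\sum_i m i * d x x)); last by rewrite lerDr dot_ge0.
apply: ler_sum => i _; rewrite /m.
have h1 := cauchy_schwarz x (c i); have h2 := cauchy_schwarz (L b`_i) x.
have := sqr_ge0 (d x (c i) - d (L b`_i) x).
have := sqr_ge0 (d x (c i)); have := sqr_ge0 (d (L b`_i) x).
nra.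
Qed.

(** Cauchy-Schwarz for [(T u, v)] at [x] and [T^-1 x] gives
    [|x|^4 <= (T x, x) (x, T^-1 x) <= (T x, x) M |x|^2], where [M] bounds the
    quadratic form of [T^-1]. *)
Lemma coercive_psd_inj (T : 'End(U)) :
  is_adjoint d d T T -> (forall u, 0 <= d (T u) u) -> lker T == 0%VS ->
  exists2 c, 0 < c & forall x, c * d x x <= d (T x) x.
Proof.
move=> symT psd injT.
have [M M0 leM] := quadratic_form_bounded (T^-1)%VF.
exists M^-1; first by rewrite invr_gt0.
move=> x; rewrite mulrC ler_pdivrMr //.
have [->|/dot_gt0 x0] := eqVneq x 0; first by rewrite !linear0r mul0r.
have := cauchy_schwarz_psd x ((T^-1)%VF x) symT psd.
rewrite symT (lker0_lfunVK injT) => cs.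
rewrite -(ler_pM2r x0) -expr2 (le_trans cs) //.
by rewrite -mulrA ler_wpM2l // (dotC x).
Qed.

(** The eigenvalue is the least [m] with [(T x, x) <= m |x|^2] for all [x]. Were
    it not an eigenvalue, [coercive_psd_inj] applied to [m - T] would provide a
    strictly smaller such [m]. *)
Lemma max_rayleigh_eigenvalue (T : 'End(U)) :
  (0 < \dim {:U})%N -> is_adjoint d d T T ->
  exists2 l, passmx.leigenvalue T l & forall x, d (T x) x <= l * d x x.
Proof.
move=> U_nz symT.
pose E := [set m | forall x, d (T x) x <= m * d x x].
have E0 : E !=set0.
  by have [M _ leM] := quadratic_form_bounded T; exists M.
have x0_nz : vpick {:U} != 0 by rewrite vpick0 -dimv_eq0 -lt0n.
have lbE x : x != 0 -> lbound E (d (T x) x / d x x).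
  by move=> /dot_gt0 x_gt0 m Em; rewrite ler_pdivrMr.
have infE : E (inf E).
  move=> x; have [->|x_nz] := eqVneq x 0; first by rewrite !linear0r mulr0.
  by rewrite -ler_pdivrMr ?dot_gt0 // lb_le_inf //; exact: lbE.
exists (inf E) => //.
pose N : 'End(U) := inf E *: \1%VF - T.
have NE u : N u = inf E *: u - T u.
  by rewrite add_lfunE opp_lfunE scale_lfunE id_lfunE.
have dN u v : d (N u) v = inf E * d u v - d (T u) v.
  by rewrite NE dotBl dotZl.
have symN : is_adjoint d d N N.
  by move=> u v; rewrite dN (dotC _ (N v)) dN symT (dotC v) (dotC (T v)).
have psdN u : 0 <= d (N u) u by rewrite dN subr_ge0.
rewrite /passmx.leigenvalue; apply/negP => /eqP ker0.
have /(coercive_psd_inj symN psdN)[c c0 coer] : lker N == 0%VS.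
  rewrite -subv0; apply/subvP => u; rewrite -ker0 !memv_ker NE.
  by rewrite add_lfunE opp_lfunE scale_lfunE id_lfunE !subr_eq0 eq_sym.
have : E (inf E - c).
  move=> x; have := coer x; rewrite dN mulrBl; lra.
have hE : has_lbound E by eexists; exact: lbE x0_nz.
by move=> /(ge_inf hE); lra.
Qed.

End RealInnerProduct.

(** * The Schur complement and the energy of lifts *)

Section SchurComplement.
Variables (R : realType) (V W : vectType R).
Variables (dV : {dot V for idfun}) (dW : {dot W for idfun}).
Variables (A : 'End(V)) (B : 'Hom(V, W)).
Hypotheses (A_spd : sym_pos_def dV A) (B_surj : limg B = fullv).

Local Notation S := (schur_complement dV dW A B).

(** Among the [v] with [B v = S q], this one has the least energy [(A v, v)]:
    it is the [A]-orthogonal representative. *)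
Definition optimal_lift q : V := (A^-1)%VF (adjoint dV dW B q).

Lemma B_optimal_lift q : B (optimal_lift q) = S q.
Proof. by rewrite !comp_lfunE. Qed.

(** The lift represents [v |-> (B v, q)] for the inner product [(A u, v)]. *)
Lemma dot_A_optimal_lift v q : dV (A v) (optimal_lift q) = dW (B v) q.
Proof. by rewrite A_spd.1 (sym_pos_def_invr A_spd) -(adjointP dV dW B). Qed.

Lemma sym_pos_def_psd v : 0 <= dV (A v) v.
Proof.
have [->|/A_spd.2/ltW //] := eqVneq v 0; by rewrite !linear0r.
Qed.

Lemma energy_optimal_lift q :
  dV (A (optimal_lift q)) (optimal_lift q) = dW (S q) q.
Proof. by rewrite dot_A_optimal_lift B_optimal_lift. Qed.

(** [(S q, q)] is the energy of the lift of [q], and the lift is injective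
    because [B] is surjective. *)
Lemma schur_sym_pos_def : sym_pos_def dW S.
Proof.
split=> [p q|q].
  rewrite -B_optimal_lift -dot_A_optimal_lift A_spd.1 dotC.
  by rewrite dot_A_optimal_lift B_optimal_lift dotC.
rewrite -energy_optimal_lift => q_nz; apply: A_spd.2.
apply: contra q_nz => /eqP lift0; apply/eqP.
apply: (dot_inj (dV := dW)) => w; rewrite linear0r.
have /memv_imgP[v _ ->] : w \in limg B by rewrite B_surj memvf.
by rewrite -dot_A_optimal_lift lift0 linear0r.
Qed.

(** Cauchy-Schwarz for the energy inner product, between [v] and the lift of
    [q]. *)
Lemma schur_cauchy_schwarz v q :
  dW (B v) q ^+ 2 <= dV (A v) v * dW (S q) q.
Proof.
rewrite -dot_A_optimal_lift -energy_optimal_lift.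
exact: cauchy_schwarz_psd A_spd.1 sym_pos_def_psd.
Qed.

Lemma schur_inv_sym_pos_def : sym_pos_def dW (S^-1)%VF.
Proof.
have [symS posS] := schur_sym_pos_def.
have SK := sym_pos_def_invr schur_sym_pos_def.
split=> [p q|q q_nz].
  by rewrite -{2}(SK p) symS SK.
rewrite -{2}(SK q) -symS SK -[X in dW X _]SK; apply: posS.
by apply: contra q_nz => /eqP Sq0; rewrite -(SK q) Sq0 linear0.
Qed.

(** The case [q = S^-1 (B v)] of [schur_cauchy_schwarz], where both
    [(B v, q)] and [(S q, q)] equal [(S^-1 (B v), B v)]. *)
Lemma schur_inv_le_energy v : dW ((S^-1)%VF (B v)) (B v) <= dV (A v) v.
Proof.
have SK := sym_pos_def_invr schur_sym_pos_def.
have [->|Bv_nz] := eqVneq (B v) 0; first by rewrite !linear0r sym_pos_def_psd.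
have pos := schur_inv_sym_pos_def.2 _ Bv_nz.
have := schur_cauchy_schwarz v ((S^-1)%VF (B v)).
by rewrite SK dotC expr2 ler_pM2r.
Qed.

End SchurComplement.

(** * The extremal eigenvalues *)

Theorem theorem4p1 (R : realType) (V W : vectType R)
    (dV : {dot V for idfun}) (dW : {dot W for idfun})
    (A : 'End(V)) (B : 'Hom(V, W))
    (W_nonzero : (0 < \dim {:W})%N)
    (A_spd : sym_pos_def dV A)
    (B_surj : limg B = fullv) :
  let S := schur_complement dV dW A B in
  exists lmin lmax : R,
    [/\ is_min_eigenvalue S lmin,
        is_max_eigenvalue S lmax,
        lmin%:E = ereal_inf
          [set ereal_sup [set (dot_norm dW q ^+ 2 / dV (A v) v)%:E
                         | v in [set v : V | B v = q]]
          | q in [set q : W | q != 0]]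
      & lmax%:E = ereal_sup
          [set (dot_norm dW (B v) ^+ 2 / dV (A v) v)%:E
          | v in [set v : V | v != 0]]].
Proof.
move=> S.
have S_spd : sym_pos_def dW S := schur_sym_pos_def dW A_spd B_surj.
have T_spd : sym_pos_def dW (S^-1)%VF :=
  schur_inv_sym_pos_def dW A_spd B_surj.
have SK : cancel (S^-1)%VF S := sym_pos_def_invr S_spd.
have KS : cancel S (S^-1)%VF := sym_pos_def_invl S_spd.
have eig_gt0 (T : 'End(W)) : sym_pos_def dW T ->
    forall (a : R) w, w != 0 -> T w = a *: w -> 0 < a.
  move=> [_ posT] a w w_nz Tw; have := posT _ w_nz.
  by rewrite Tw dotZl pmulr_lgt0 ?dot_gt0.
have [lmax lmax_eig lmax_ub] := max_rayleigh_eigenvalue W_nonzero S_spd.1.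
have [mu mu_eig mu_ub] := max_rayleigh_eigenvalue W_nonzero T_spd.1.
have [p p_nz Sp] := (eigenvalueP _ _).1 lmax_eig.
have [q q_nz Tq] := (eigenvalueP _ _).1 mu_eig.
have lmax_gt0 := eig_gt0 _ S_spd _ _ p_nz Sp.
have mu_gt0 := eig_gt0 _ T_spd _ _ q_nz Tq.
exists mu^-1, lmax; split.
- split.
    apply/eigenvalueP; exists q => //.
    by rewrite -{2}(SK q) Tq linearZ scalerA mulVf ?gt_eqF // scale1r.
  move=> m /eigenvalueP[w w_nz Sw].
  have m_gt0 := eig_gt0 _ S_spd _ _ w_nz Sw.
  have := mu_ub (S w); rewrite KS Sw !dotZl !dotZr => le_m.
  have mw_gt0 : 0 < m * dW w w by rewrite mulr_gt0 // dot_gt0.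
  rewrite -[leLHS]mul1r ler_pdivrMr // -(ler_pM2r mw_gt0) mul1r.
  by apply: le_trans le_m _; rewrite !mulrA (mulrC mu m).
- split=> // m /eigenvalueP[w w_nz Sw].
  by have := lmax_ub w; rewrite Sw dotZl ler_pM2r // dot_gt0.
- apply/eqP; rewrite eq_le; apply/andP; split.
    apply: le_ereal_inf_tmp => _ [w w_nz <-].
    (* The lift of [S^-1 w] has the least energy among the [v] over [w]. *)
    pose v := optimal_lift dV dW A B ((S^-1)%VF w).
    have Bv : B v = w by rewrite B_optimal_lift SK.
    apply: le_trans (ereal_sup_ubound _); last by exists v.
    rewrite lee_fin dot_normE energy_optimal_lift // SK dotC.
    rewrite ler_pdivlMr ?(T_spd.2 _ w_nz) // mulrC ler_pdivrMr // mulrC.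
    exact: mu_ub.
  (* At the eigenvector [q] every lift has energy at least [mu |q|^2]. *)
  apply: le_trans (ereal_inf_lbound _) _; first by exists q.
  apply: ge_ereal_sup => _ [v /= Bv <-].
  have := schur_inv_le_energy dW A_spd B_surj v.
  rewrite Bv Tq dotZl dot_normE => le_v.
  have q_gt0 := dot_gt0 dW q_nz.
  have Av_gt0 : 0 < dV (A v) v by apply: lt_le_trans le_v; rewrite mulr_gt0.
  by rewrite lee_fin ler_pdivrMr // mulrC ler_pdivlMr // mulrC.
- apply/eqP; rewrite eq_le; apply/andP; split.
    pose v := optimal_lift dV dW A B p.
    have Bv : B v = lmax *: p by rewrite B_optimal_lift Sp.
    have p_gt0 := dot_gt0 dW p_nz.
    apply: le_trans (ereal_sup_ubound _); last first.
      exists v => //=; apply: contra p_nz => /eqP v0.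
      move/eqP: Bv; rewrite v0 linear0 eq_sym scaler_eq0.
      by rewrite (gt_eqF lmax_gt0).
    rewrite lee_fin dot_normE energy_optimal_lift // -/S Sp Bv.
    rewrite !dotZl !dotZr mulfK //.
    by rewrite gt_eqF // mulr_gt0.
  apply: ge_ereal_sup => _ [v /= v_nz <-].
  have Av_gt0 := A_spd.2 _ v_nz.
  rewrite lee_fin dot_normE ler_pdivrMr //.
  have [->|Bv_nz] := eqVneq (B v) 0.
    by rewrite linear0r mulr_ge0 // ltW.
  have Bv_gt0 := dot_gt0 dW Bv_nz.
  rewrite -(ler_pM2r Bv_gt0) -expr2.
  apply: le_trans (schur_cauchy_schwarz dW B A_spd v (B v)) _.
  by rewrite mulrAC mulrC ler_pM2r // lmax_ub.
Qed.
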